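(* Read's Banach space $E_{\mathrm R}$ does not have the uniform primary factorisation property.
   Context: For a Banach space $E$, $\mathcal{B}(E)$ denotes the Banach algebra of bounded linear operators on $E$, $\mathrm{Id}_E$ the identity operator, and $\mathcal{W}(E)$ the closed two-sided ideal of weakly compact operators. For $C\ge 1$, $E$ has the $C$-primary factorisation property ($C$-PFP) if for every $T\in\mathcal{B}(E)$ there are $U,V\in\mathcal{B}(E)$ with $UTV=\mathrm{Id}_E$ or $U(\mathrm{Id}_E-T)V=\mathrm{Id}_E$ and $\|U\|\,\|V\|\le C$. $E$ has the uniform primary factorisation property (UPFP) if it has the $C$-PFP for some $C\ge 1$. $E_{\mathrm R}$ denotes the Banach space constructed by C. J. Read in ''Discontinuous derivations on the algebra of bounded operators on a Banach space'', J. London Math. Soc. (2) 40 (1989), 305--326. The following property of $E_{\mathrm R}$ is established in that article of Read and may be taken as known: there is a closed two-sided ideal $\mathcal{J}_{\mathrm R}$ of $\mathcal{B}(E_{\mathrm R})$ of codimension one such that $\mathcal{W}(E_{\mathrm R})\subsetneq\mathcal{J}_{\mathrm R}$ and $\mathcal{J}_{\mathrm R}^2\subseteq\mathcal{W}(E_{\mathrm R})$ (that is, $ST\in\mathcal{W}(E_{\mathrm R})$ for all $S,T\in\mathcal{J}_{\mathrm R}$). *)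

(* Defs.v *)
From mathcomp Require Import all_boot all_order all_algebra.
From mathcomp Require Import all_classical all_reals all_analysis.
From mathcomp Require Import complex.

Set Implicit Arguments.
Unset Strict Implicit.
Unset Printing Implicit Defensive.

Import Order.TTheory GRing.Theory Num.Theory.
Import numFieldNormedType.Exports.

Local Open Scope classical_set_scope.
Local Open Scope ring_scope.

Variant scalar_kind := RealScalars | ComplexScalars.

Definition scalar_field (R : realType) (k : scalar_kind) : numFieldType :=
  match k with RealScalars => R | ComplexScalars => R[i] end.

(* A normed module over K has a K-valued norm; [real_part] brings the norms,
   which are real elements of K, back to R, where suprema exist. *)
Definition real_part (R : realType) (k : scalar_kind) : scalar_field R k -> R :=
  match k return scalar_field R k -> R with
  | RealScalars => fun a : R => a
  | ComplexScalars => fun a : R[i] => complex.Re a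
  end.

Section BoundedOperators.
Variables (R : realType) (k : scalar_kind).
Local Notation K := (scalar_field R k).

Definition bounded_linear (E F : normedModType K) : set (E -> F) :=
  [set T : E -> F | linear T /\ exists M : K, forall x, `|T x| <= M * `|x|].

Definition dual (E : normedModType K) : Type :=
  {f : E -> K^o | bounded_linear f}.

Definition evaluation (E : normedModType K) (x : E) : {ptws dual E -> K^o} :=
  fun f => sval f x.

(* The carrier of E, with the coarsest topology making all the elements of the
   dual continuous. *)
Local Notation weak E := (initial_topology (@evaluation E)).

Variable E : normedModType K.

Definition bounded_ops : set (E -> E) := @bounded_linear E E.

Definition opnorm (T : E -> E) : R :=
  sup [set real_part `|T x| | x in [set x : E | `|x| <= 1]].

Definition weakly_compact_ops : set (E -> E) :=
  [set T | bounded_ops T /\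
    compact (closure (T @` [set x : E | `|x| <= 1] : set (weak E)))].

Definition two_sided_ideal (J : set (E -> E)) : Prop :=
  [/\ J `<=` bounded_ops,
      J 0,
      forall (a : K) (S T : E -> E), J S -> J T -> J (a *: S + T),
      forall U S : E -> E, bounded_ops U -> J S -> J (U \o S) &
      forall U S : E -> E, bounded_ops U -> J S -> J (S \o U)].

Definition opnorm_closed (J : set (E -> E)) : Prop :=
  forall T : E -> E, bounded_ops T ->
    (forall e : R, 0 < e -> exists2 S, J S & opnorm (T - S) < e) -> J T.

(* The quotient of the space of bounded operators by J is spanned by the class
   of S, which is not zero. *)
Definition codimension_one (J : set (E -> E)) : Prop :=
  exists S : E -> E, [/\ bounded_ops S, ~ J S &
    forall T : E -> E, bounded_ops T -> exists a : K, J (T - a *: S)].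

Definition PFP (C : R) : Prop :=
  forall T : E -> E, bounded_ops T ->
    exists U V : E -> E, [/\ bounded_ops U, bounded_ops V,
      U \o T \o V = id \/ U \o (id - T) \o V = id &
      opnorm U * opnorm V <= C].

Definition UPFP : Prop := exists2 C : R, 1 <= C & PFP C.

End BoundedOperators.

Arguments bounded_ops {R k} E.
Arguments weakly_compact_ops {R k} E.
Arguments PFP {R k} E C.
Arguments UPFP {R k} E.

(* Main.v *)
Require Import Defs.
From mathcomp Require Import all_boot all_order all_algebra.
From mathcomp Require Import all_classical all_reals all_analysis.
From mathcomp Require Import complex ring lra.

(** Every operator is a scalar plus an element of J.  Let T in J be not weakly
    compact and t > 0.  The factorisation property cannot factor the identity
    through tT, so U(1 - tT)V = 1 with |U||V| <= C, whence |UTV| <= (C + 1)/t.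
    Writing U = u + j and V = v + j' with j, j' in J gives uv = 1, and
    UTV = T + j(TV) + (uT)j' differs from T by a weakly compact operator, since
    J^2 consists of such operators.  Letting t tend to infinity, T is a norm
    limit of weakly compact operators, hence weakly compact: a contradiction. *)

Set Implicit Arguments.
Unset Strict Implicit.
Unset Printing Implicit Defensive.

Import Order.TTheory GRing.Theory Num.Theory.
Import numFieldNormedType.Exports.

Local Open Scope classical_set_scope.
Local Open Scope ring_scope.

(** * The Hahn-Banach theorem, by minimal sublinear functionals *)

Section HahnBanach.
Variables (R : realType) (K : pzRingType) (iota : {rmorphism R -> K}).
Variable V : lmodType K.

(** Real scalars act through [iota], so complex spaces are covered. Homogeneity is an inequality,
    which passes to infima; applying it to [t^-1] gives equality for positive [t]. *)
Definition sublinear (q : V -> R) : Prop :=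
  (forall x y, q (x + y) <= q x + q y) /\
  (forall (t : R) x, 0 <= t -> q (iota t *: x) <= t * q x).

Lemma sublinear0 q : sublinear q -> q 0 = 0.
Proof.
case=> qD qZ; apply/eqP; rewrite eq_le; apply/andP; split.
  by have := qZ 0 0 (lexx _); rewrite scaler0 mul0r.
by have := qD 0 0; rewrite addr0; lra.
Qed.

Lemma sublinearZ q t x : sublinear q -> 0 <= t -> q (iota t *: x) = t * q x.
Proof.
move=> sq; have [_ qZ] := sq; rewrite le_eqVlt => /predU1P[<-|t0].
  by rewrite rmorph0 scale0r mul0r sublinear0.
apply/eqP; rewrite eq_le qZ ?(ltW t0)//= -ler_pdivlMl//.
have := qZ t^-1 (iota t *: x).
rewrite scalerA -rmorphM mulVf ?gt_eqF// rmorph1 scale1r.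
by rewrite invr_ge0 ltW//; apply.
Qed.

(** The lower bound [m] keeps the infima finite. For a chain, [k] is the smaller of two functionals;
    for tilts, it is the sum or a multiple of the parameters. *)
Lemma sublinear_inf (I : Type) (i0 : I) (g : I -> V -> R) (m : V -> R) :
  (forall i x, m x <= g i x) ->
  (forall i j x y, exists k, g k (x + y) <= g i x + g j y) ->
  (forall i t x, 0 <= t -> exists k, g k (iota t *: x) <= t * g i x) ->
  sublinear (fun x => inf [set g i x | i in [set: I]]).
Proof.
move=> mg gD gZ.
have infle i x : inf [set g i x | i in [set: I]] <= g i x.
  by apply: ge_inf; [exists (m x) => _ [j _ <-] | exists i].
have infne x : [set g i x | i in [set: I]] !=set0 by exists (g i0 x), i0.
split=> [x y|t x t0].
  rewrite -lerBlDr; apply: lb_le_inf => // _ [i _ <-].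
  rewrite lerBlDr -lerBlDl; apply: lb_le_inf => // _ [j _ <-].
  by have [k gk] := gD i j x y; rewrite lerBlDl (le_trans (infle k _)).
have : 0 <= t := t0; rewrite le_eqVlt => /predU1P[t_0|t_gt0].
  have [k] := gZ i0 _ x t0; rewrite -t_0 !mul0r; exact/le_trans/infle.
rewrite -ler_pdivrMl//; apply: lb_le_inf => // _ [i _ <-].
have [k gk] := gZ i _ x t0.
by rewrite ler_pdivrMl// (le_trans (infle k _)).
Qed.

Section Tilt.
Variables (q : V -> R) (y : V).

(** For sublinear [q], this is the largest sublinear functional below [q] whose value at [- y] is at
    most [- q y]. The norm lets [t] range over all of [R] while only nonnegative multiples of [y]
    occur. *)
Definition tilt (x : V) : R :=
  inf [set q (x + iota (Num.norm t) *: y) - `|t| * q y | t in [set: R]].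

Hypothesis sq : sublinear q.

Let tilt_lb (t : R) x : - q (- x) <= q (x + iota `|t| *: y) - `|t| * q y.
Proof.
have [qD _] := sq; have := qD (x + iota `|t| *: y) (- x).
by rewrite addrAC subrr add0r sublinearZ//; lra.
Qed.

Lemma tilt_le_at (t : R) x : 0 <= t -> tilt x <= q (x + iota t *: y) - t * q y.
Proof.
move=> t0; apply: ge_inf; last by exists t; rewrite ?ger0_norm.
by exists (- q (- x)) => _ [s _ <-].
Qed.

Lemma tilt_le x : tilt x <= q x.
Proof.
by have := tilt_le_at x (lexx 0); rewrite rmorph0 scale0r addr0 mul0r subr0.
Qed.

Lemma tilt_sublinear : sublinear tilt.
Proof.
have [qD qZ] := sq.
apply: (@sublinear_inf _ 0 _ (fun x => - q (- x))) => [s x|s s' x x'|s t x t0].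
- exact: tilt_lb.
- exists (`|s| + `|s'|); rewrite [`| _ + _ |]ger0_norm ?addr_ge0//.
  rewrite rmorphD scalerDl addrACA mulrDl.
  by have := qD (x + iota `|s| *: y) (x' + iota `|s'| *: y); lra.
- exists (t * s); rewrite normrM (ger0_norm t0) rmorphM -scalerA -scalerDr.
  rewrite sublinearZ//; lra.
Qed.

Lemma tiltN : tilt (- y) <= - q y.
Proof.
have := tilt_le_at (- y) ler01.
by rewrite rmorph1 scale1r addNr (sublinear0 sq) mul1r sub0r.
Qed.

End Tilt.

(** Zorn's lemma: a nonempty chain is bounded by its pointwise infimum, finite because [q <= p]
    forces [- p (- x) <= q x]. *)
Lemma minimal_sublinear p : sublinear p ->
  exists q, [/\ sublinear q, (forall x, q x <= p x) &
    forall r, sublinear r -> (forall x, r x <= q x) -> forall x, q x <= r x].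
Proof.
move=> sp; pose T := {q : V -> R | sublinear q /\ forall x, q x <= p x}.
(* The order is reversed, so that Zorn's maximal elements are minimal functionals. *)
pose below (q r : T) := `[< forall x, sval r x <= sval q x >].
have p_lb (q : T) x : - p (- x) <= sval q x.
  have [sq qp] := svalP q; have [qD _] := sq; have := qD x (- x).
  by rewrite subrr (sublinear0 sq); have := qp (- x); lra.
pose mkT q (sq : sublinear q) (qp : forall x, q x <= p x) : T :=
  exist _ q (conj sq qp).
have t0 : T by exists p.
have [||A Atot|q qmin] := @ZL_preorder T t0 below.
- by move=> q; apply/asboolP.
- move=> q r s /asboolP rq /asboolP qs; apply/asboolP => x.
  exact: le_trans (qs x) (rq x).
- have [[a0 Aa0]|Aempty] := pselect (A !=set0); last first.
    by exists t0 => s As; case: Aempty; exists s.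
  pose g (i : {q : T | A q}) := sval (sval i).
  have gp i x : - p (- x) <= g i x by exact: p_lb.
  pose i0 : {q : T | A q} := exist _ a0 Aa0.
  have infle i x : inf [set g i x | i in setT] <= g i x.
    by apply: ge_inf; [exists (- p (- x)) => _ [j _ <-]; exact: gp|exists i].
  have sinf : sublinear (fun x => inf [set g i x | i in setT]).
    apply: (sublinear_inf i0 gp) => [[q Aq] [r Ar] x y|[q Aq] t x t0'].
      have [[qD _] _] := svalP q; have [[rD _] _] := svalP r.
      have [/asboolP rq|/asboolP qr] := Atot _ _ Aq Ar.
        exists (exist _ r Ar); rewrite /g /=; have := rD x y.
        by have := rq x; lra.
      exists (exist _ q Aq); rewrite /g /=; have := qD x y.
      by have := qr y; lra.
    by have [[_ qZ] _] := svalP q; exists (exist _ q Aq); exact: qZ.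
  have infp x : inf [set g i x | i in setT] <= p x.
    by apply: le_trans (infle i0 x) _; have [_] := svalP a0; apply.
  exists (mkT _ sinf infp) => s As; apply/asboolP => x /=.
  exact: (infle (exist _ s As)).
have [sq qp] := svalP q; exists (sval q); split=> // r sr rq.
have rp x : r x <= p x by exact: le_trans (rq x) (qp x).
have /qmin/asboolP// : below q (mkT r sr rp) by exact/asboolP.
Qed.

(* A minimal sublinear functional coincides with all its tilts, hence is odd
   and therefore additive.  Minimising below the tilt of p at z forces the
   value p z at z. *)
Theorem hahn_banach p z : sublinear p ->
  exists f : V -> R, [/\ {morph f : x y / x + y},
    forall (t : R) x, f (iota t *: x) = t * f x,
    forall x, f x <= p x & f z = p z].
Proof.
move=> sp; have [f [sf fp fmin]] := minimal_sublinear (tilt_sublinear z sp).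
have fN x : f (- x) = - f x.
  have := fmin _ (tilt_sublinear x sf) (tilt_le x sf) (- x).
  have := tiltN x sf; have [fD _] := sf; have := fD x (- x).
  by rewrite subrr (sublinear0 sf); lra.
have fle x : f x <= p x by apply: le_trans (fp x) (tilt_le z sp x).
exists f; split=> //.
- move=> x y; have [fD _] := sf.
  (* Subadditivity at [- x] and [- y] becomes, by oddness, the reverse inequality. *)
  by have := fD x y; have := fD (- x) (- y); rewrite -opprD !fN; lra.
- move=> t x; have [t0|/ltW t0] := leP 0 t; first exact: sublinearZ.
  by rewrite -{1}[t]opprK rmorphN scaleNr fN sublinearZ ?oppr_ge0// mulNr opprK.
- by have := tiltN z sp; have := fp (- z); have := fle z; rewrite fN; lra.
Qed.

End HahnBanach.

(** * Real-valued norms over either scalar field *)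

Section RealPart.
Variables (R : realType) (k : scalar_kind).
Local Notation K := (scalar_field R k).

Definition embed : {rmorphism R -> K} :=
  match k return {rmorphism R -> scalar_field R k} with
  | RealScalars => idfun
  | ComplexScalars => real_complex R
  end.

Lemma embed_le a b : (embed a <= embed b) = (a <= b).
Proof. by rewrite /embed; case: k => //; rewrite lecR. Qed.

Lemma embed_lt a b : (embed a < embed b) = (a < b).
Proof. by rewrite /embed; case: k => //; rewrite ltcR. Qed.

Lemma embed_ge0 a : (0 <= embed a) = (0 <= a).
Proof. by rewrite -embed_le rmorph0. Qed.

Lemma embed_gt0 a : (0 < embed a) = (0 < a).
Proof. by rewrite -embed_lt rmorph0. Qed.

Lemma norm_embed a : `|embed a| = embed `|a|.
Proof.
have [a0|/ltW a0] := leP 0 a.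
  by rewrite !ger0_norm ?embed_ge0.
by rewrite !ler0_norm ?rmorphN// -oppr_ge0 -rmorphN embed_ge0 oppr_ge0.
Qed.

Lemma embed_real_part (x : K) : x \is Num.real -> embed (real_part x) = x.
Proof. by rewrite /embed; case: k x => [x|x /RRe_real]. Qed.

Lemma real_partK a : real_part (embed a) = a.
Proof. by rewrite /embed; case: k. Qed.

Variable E : normedModType K.

Definition rnorm (x : E) : R := real_part `|x|.

Lemma embed_rnorm x : embed (rnorm x) = `|x|.
Proof. exact/embed_real_part/normr_real. Qed.

Lemma rnorm_ge0 x : 0 <= rnorm x.
Proof. by rewrite -embed_le rmorph0 embed_rnorm. Qed.

Lemma rnorm0 : rnorm 0 = 0.
Proof. by rewrite -[RHS]real_partK rmorph0 /rnorm normr0. Qed.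

Lemma rnorm_eq0 x : rnorm x = 0 -> x = 0.
Proof. by move=> x0; apply/normr0_eq0; rewrite -embed_rnorm x0 rmorph0. Qed.

Lemma rnormD x y : rnorm (x + y) <= rnorm x + rnorm y.
Proof. by rewrite -embed_le rmorphD !embed_rnorm ler_normD. Qed.

Lemma rnormN x : rnorm (- x) = rnorm x.
Proof. by rewrite /rnorm normrN. Qed.

Lemma rnormZ t x : 0 <= t -> rnorm (embed t *: x) = t * rnorm x.
Proof.
move=> t0; rewrite /rnorm normrZ norm_embed -embed_rnorm -rmorphM !real_partK.
by rewrite ger0_norm.
Qed.

Lemma rnorm_le1 x : (`|x| <= 1) = (rnorm x <= 1).
Proof. by rewrite -embed_le embed_rnorm rmorph1. Qed.

Lemma sublinear_rnorm : sublinear embed rnorm.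
Proof. by split=> [x y|t x t0]; [exact: rnormD | rewrite rnormZ]. Qed.

End RealPart.

(** * Norming functionals over either scalar field *)

Lemma linear_complexification (R K : comPzRingType) (e : {rmorphism R -> K})
    (i : K) (re im : K -> R) (V : lmodType K) (g : V -> R) :
  i * i = -1 -> (forall a, a = e (re a) + i * e (im a)) ->
  {morph g : x y / x + y} -> (forall t x, g (e t *: x) = t * g x) ->
  linear (fun x => e (g x) - i * e (g (i *: x)) : K^o).
Proof.
move=> ii reim gD gZ a u v.
have g0 : g 0 = 0 by rewrite -(scaler0 _ (e 0)) gZ mul0r.
have gN x : g (- x) = - g x.
  by apply/eqP; rewrite -subr_eq0 opprK -gD addNr g0.
have giZ x : g (a *: x) = re a * g x + im a * g (i *: x).
  by rewrite {1}(reim a) scalerDl gD gZ [i * _]mulrC -scalerA gZ.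
rewrite scalerDr !gD scalerA [i * a]mulrC -scalerA !giZ scalerA ii scaleN1r gN.
rewrite -[a *: _]/(a * _) [in RHS](reim a) !(rmorphD, rmorphM, rmorphN).
(* The six values of [e] become free variables: what remains is a polynomial identity modulo
   [i * i = -1]. *)
move: (e _) (e _) (e _) (e _) (e _) (e _) => p q r s t w.
ring: ii.
Qed.

(* The factor 2 spares the usual rotation argument in the complex case: the
   complexification g x - i g(ix) of a real functional g with g <= |.| is
   bounded by |g x| + |g(ix)|. *)
Lemma norming_functional (R : realType) (k : scalar_kind)
    (E : normedModType (scalar_field R k)) (z : E) :
  exists f : E -> (scalar_field R k)^o,
    [/\ linear f, forall x, `|f x| <= 2 * `|x| & `|z| <= `|f z|].
Proof.
have [g [gD gZ gle gz]] := hahn_banach z (sublinear_rnorm E).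
have gN x : g (- x) = - g x.
  by rewrite -scaleN1r -(rmorph1 (embed R k)) -rmorphN gZ mulN1r.
have gabs x : `|g x| <= rnorm x.
  by rewrite ler_norml gle andbT -(rnormN x) -[g x]opprK lerN2 -gN gle.
case: k E z g gD gZ gle gz gN gabs => E z g gD gZ gle gz gN gabs.
  exists g; split=> [a u v|x|].
  - by rewrite gD; congr (_ + _); exact: gZ.
  - apply: le_trans (gabs x) _; rewrite -[rnorm x]/(`|x|).
    by rewrite mulr_natl mulr2n lerDl.
  - by rewrite gz; exact: ler_norm.
pose i : R[i] := 'i%C.
have ii : i * i = -1 by rewrite -expr2 sqr_i.
have ni : `|i| = 1 by rewrite normc_def /= expr0n expr1n add0r sqrtr1.
have rc (a : R[i]) : a = (complex.Re a)%:C%C + i * (complex.Im a)%:C%C.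
  exact: complexE.
pose e := embed R ComplexScalars.
exists (fun x => e (g x) - i * e (g (i *: x))); split=> [|x|].
- exact: (linear_complexification ii rc gD gZ).
- rewrite (le_trans (ler_normB _ _))// normrM ni mul1r mulr_natl mulr2n.
  have le y : `|e (g y)| <= `|y|.
    by rewrite -(embed_rnorm y) norm_embed embed_le.
  by rewrite lerD// (le_trans (le _))// normrZ ni mul1r.
- rewrite -(embed_rnorm z) -gz.
  (* The real part of the complexification is [g], so its modulus at [z] is at least [g z], which is
     the norm of [z]. *)
  set w := _ - _; have -> : g z = complex.Re w.
    by rewrite /w /=; ring.
  rewrite normc_def lecR (le_trans (ler_norm _))// -sqrtr_sqr ler_wsqrtr//.
  by rewrite lerDl sqr_ge0.
Qed.

(** * Compactness through ultrafilters *)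

Lemma ultra_fmap (S T : Type) (f : S -> T) (F : set_system S) :
  UltraFilter F -> UltraFilter (f @ F).
Proof.
move=> FU; have FP := ultra_proper; split; first exact: fmap_proper_filter.
move=> G GP sFG; rewrite eqEsubset; split=> // A GA.
(* Otherwise [G], which is finer than the image of [F], contains both [A] and its complement. *)
have [//|FnA] := in_ultra_setVsetC (f @^-1` A) FU.
by have [x []] := filter_ex (filterI GA (sFG (~` A) FnA)).
Qed.

(* Given an ultrafilter G containing the closure of A, the traces on A of the
   open members of G generate a filter, whose limits are limits of G by
   regularity. *)
Lemma compact_closure_image (S : Type) (X : uniformType) (T : S -> X)
    (B : set S) :
  (forall F : set_system S, UltraFilter F -> F B ->
     exists y : X, T x @[x --> F] --> y) ->
  compact (closure (T @` B)).
Proof.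
move=> cvgB; rewrite compact_ultra => G GU GA.
have GP : ProperFilter G by exact: ultra_proper.
pose H : set_system S :=
  filter_from [set U : set X | open U /\ G U] (fun U => B `&` T @^-1` U).
have HP : ProperFilter H.
  apply: filter_from_proper.
    apply: filter_from_filter.
      by exists setT; split; [exact: openT|exact: filterT].
    move=> U V [oU GU'] [oV GV]; exists (U `&` V).
      by split; [exact: openI|exact: filterI].
    by move=> x [Bx [Ux Vx]].
  move=> U [oU GU']; have [x [Ux Ax]] := filter_ex (filterI GU' GA).
  have [_ [[z Bz <-] Uz]] := Ax U (open_nbhs_nbhs (conj oU Ux)).
  by exists z.
have [F [FU sHF]] := ultraFilterLemma HP.
have FP : ProperFilter F by exact: ultra_proper.
have FB : F B.
  by apply: sHF; exists setT => [|x []//]; split; [exact: openT|exact: filterT].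
have [y Ty] := cvgB F FU FB; exists y; split.
  move=> N /Ty FN.
  have [x [Bx Nx]] := filter_ex (filterI FB (FN : F (T @^-1` N))).
  by exists (T x); split=> //; exists x.
move=> N /uniform_regular[M My MN]; apply: filterS MN _.
(* Otherwise the open complement of [closure M] belongs to [G], and its preimage, lying in [F],
   misses that of [M], also in [F]. *)
have [//|GnM] := in_ultra_setVsetC (closure M) GU.
have FnM : F (T @^-1` (~` closure M)).
  apply: sHF; exists (~` closure M) => [|x []//]; split=> //.
  by rewrite openC; exact: closed_closure.
have FM : F (T @^-1` M) := Ty _ My.
have [x [nMx /subset_closure clMx]] := filter_ex (filterI FnM FM).
by case: (nMx clMx).
Qed.

Lemma cvg_initial (S : choiceType) (T : topologicalType) (f : S -> T)
    (F : set_system S) (x : S) : Filter F ->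
  F --> (x : initial_topology f) <-> f @ F --> f x.
Proof.
move=> FF; split=> [Fx|fFx N].
  exact: cvg_comp Fx (@initial_continuous _ _ f x).
case=> _ [[U oU <-] Ux] /filterS; apply.
by apply: fFx; exact: open_nbhs_nbhs.
Qed.

(** * Weakly compact operators *)

Section WeaklyCompact.
Variables (R : realType) (k : scalar_kind).
Local Notation K := (scalar_field R k).
Variable E : normedModType K.
Local Notation weak := (initial_topology (@evaluation R k E)).
Implicit Types (f : E -> K^o) (S T : E -> E).

(** The weak topology is pulled back from a product, whose topology is the supremum of those induced
    by its coordinates, one for each functional. *)
Lemma cvg_weakP (F : set_system E) (x : E) : Filter F ->
  F --> (x : weak) <-> forall f, bounded_linear f -> f y @[y --> F] --> f x.
Proof.
move=> FF; rewrite cvg_initial; split=> [/cvg_sup Fx f bf|cvf].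
  by move: (Fx (exist _ f bf)) => /cvg_initial; apply.
by apply/cvg_sup => -[f bf]; apply/cvg_initial; exact: cvf.
Qed.

(** This criterion reduces sums and norm limits of operators to limits of scalars. The forward
    direction applies compactness to the image ultrafilter under [T]. *)
Lemma weakly_compactP T : bounded_ops E T ->
  weakly_compact_ops E T <->
  forall F : set_system E, UltraFilter F -> F [set x | `|x| <= 1] ->
    exists y, forall f, bounded_linear f -> f (T x) @[x --> F] --> f y.
Proof.
move=> bT; split=> [[_ +] F FU FB|cvT].
  rewrite compact_ultra => /(_ (T @ F) (ultra_fmap T FU))[|y [_ Ty]].
    have FP : ProperFilter F by exact: ultra_proper.
    change (F (T @^-1` closure (T @` [set x | `|x| <= 1] : set weak))).
    apply: filterS FB => x xB.
    by apply: (@subset_closure weak); exists x.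
  have FP : ProperFilter F by exact: ultra_proper.
  by exists y => f bf; exact: (iffLR (cvg_weakP y (fmap_filter T FP)) Ty f bf).
split=> //; apply: compact_closure_image => F FU /(cvT F FU)[y Ty]; exists y.
have FP : ProperFilter F by exact: ultra_proper.
exact: (iffRL (cvg_weakP y (fmap_filter T FP)) Ty).
Qed.

Lemma bounded_opsD S T : bounded_ops E S -> bounded_ops E T ->
  bounded_ops E (S + T).
Proof.
move=> [lS [M SM]] [lT [N TN]]; split=> [a x y|].
  by rewrite !fctE lS lT scalerDr addrACA.
exists (M + N) => x; rewrite mulrDl (le_trans (ler_normD _ _))//.
by rewrite lerD.
Qed.

Lemma weakly_compact_opsD S T :
  weakly_compact_ops E S -> weakly_compact_ops E T ->
  weakly_compact_ops E (S + T).
Proof.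
move=> wS wT; have [[bS _] [bT _]] := (wS, wT).
apply/weakly_compactP => [|F FU FB]; first exact: bounded_opsD.
have [y yS] := iffLR (weakly_compactP bS) wS F FU FB.
have [z zT] := iffLR (weakly_compactP bT) wT F FU FB.
exists (y + z) => f bf; have [lf _] := bf.
have fD u v : f (u + v) = f u + f v by have := lf 1 u v; rewrite !scale1r.
have FP : ProperFilter F by exact: ultra_proper.
under eq_fun do rewrite fD; rewrite fD.
by apply: cvgD; [exact: yS|exact: zT].
Qed.

End WeaklyCompact.

(** * Linear maps as plain functions, and norm bounds for limits *)

Section LinearMaps.
Variables (K : pzRingType) (E F : lmodType K) (f : E -> F).
Hypothesis lf : linear f.

Lemma linD x y : f (x + y) = f x + f y.
Proof. by have := lf 1 x y; rewrite !scale1r. Qed.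

Lemma lin0 : f 0 = 0.
Proof. by apply: (addrI (f 0)); rewrite -linD !addr0. Qed.

Lemma linZ a x : f (a *: x) = a *: f x.
Proof. by have := lf a x 0; rewrite lin0 !addr0. Qed.

Lemma linB x y : f (x - y) = f x - f y.
Proof. by rewrite -scaleN1r linD linZ scaleN1r. Qed.

End LinearMaps.

Lemma cvg_norm_le (K : numFieldType) (V : normedModType K) (T : Type)
    (F : set_system T) (h : T -> V) (l : V) (c : K) (B : set T) :
  ProperFilter F -> F B -> h x @[x --> F] --> l ->
  (forall x, B x -> `|h x| <= c) -> `|l| <= c.
Proof.
move=> FP FB hl hc; apply/ler_addgt0Pr => e e0.
have [x [Bx lx]] := filter_ex (filterI FB (cvgr_dist_lt _ _ hl _ e0)).
rewrite -(subrK (h x) l) addrC (le_trans (ler_normD _ _))// lerD ?hc//.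
exact: ltW.
Qed.

(** * Operator norm bounds and norm limits of weakly compact operators *)

Section BoundedOperators.
Variables (R : realType) (k : scalar_kind).
Local Notation K := (scalar_field R k).

Lemma near_infty_natSinv_scalar (e : K) : 0 < e ->
  \forall n \near \oo, n.+1%:R^-1 < e.
Proof.
move=> e0; have er : embed R k (real_part e) = e.
  exact/embed_real_part/gtr0_real.
have re0 : 0 < real_part e by rewrite -(embed_gt0 k) er.
near=> n.
have : n.+1%:R^-1 < real_part e.
  by near: n; exact: (near_infty_natSinv_lt (PosNum re0)).
by rewrite -(embed_lt k) er fmorphV rmorph_nat.
Unshelve. all: by end_near. Qed.

Lemma bounded_linear_gt0 (E F : normedModType K) (f : E -> F) :
  bounded_linear f ->
  exists2 M : R, 0 < M & forall x, rnorm (f x) <= M * rnorm x.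
Proof.
(* On the zero space [M] can be any scalar, whence the absolute value; the added 1 makes the bound
   positive. *)
move=> [_ [M fM]]; exists (real_part `|M| + 1) => [|x].
  by rewrite ltr_wpDl// -(embed_ge0 k) embed_real_part ?normr_real.
rewrite -(embed_le k) rmorphM rmorphD rmorph1 !embed_rnorm.
have Mx0 : 0 <= M * `|x| by exact: le_trans (fM x).
rewrite mulrDl mul1r (le_trans (fM x))// -(ger0_norm Mx0) normrM normr_id.
by rewrite lerDl.
Qed.

Lemma rnorm_le_opnorm (E : normedModType K) (T : E -> E) x :
  bounded_ops E T -> rnorm x <= 1 -> rnorm (T x) <= opnorm T.
Proof.
move=> /bounded_linear_gt0[M M0 TM] x1.
apply: ub_le_sup; last by exists x => //=; rewrite rnorm_le1.
exists M => _ [v + <-]; rewrite /= rnorm_le1 => v1.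
by apply: le_trans (TM v) _; rewrite ler_piMr// ltW.
Qed.

Lemma opnorm_ge0 (E : normedModType K) (T : E -> E) : bounded_ops E T ->
  0 <= opnorm T.
Proof.
move=> bT; apply: le_trans (rnorm_ge0 (T 0)) (rnorm_le_opnorm bT _).
by rewrite rnorm0.
Qed.

Lemma opnorm_ub (E : normedModType K) (T : E -> E) x : bounded_ops E T ->
  rnorm (T x) <= opnorm T * rnorm x.
Proof.
move=> bT; have [lT _] := bT.
have := rnorm_ge0 x; rewrite le_eqVlt => /predU1P[x0|x0].
  by rewrite -x0 mulr0 (rnorm_eq0 (esym x0)) lin0// rnorm0.
have := @rnorm_le_opnorm E T (embed R k (rnorm x)^-1 *: x) bT.
rewrite linZ// !rnormZ ?invr_ge0 ?(ltW x0)// mulVf ?gt_eqF// ler_pdivrMl//.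
by rewrite mulrC; exact.
Qed.

Variable E : completeNormedModType K.

(* For an ultrafilter on the unit ball, the weak limits along approximants of
   T form a Cauchy sequence, because norming functionals turn weak limits into
   norm estimates; its norm limit is the weak limit along T. *)
Lemma weakly_compact_ops_closed (T : E -> E) : bounded_ops E T ->
  (forall e : R, 0 < e -> exists2 S, weakly_compact_ops E S &
     forall x, rnorm (T x - S x) <= e * rnorm x) ->
  weakly_compact_ops E T.
Proof.
move=> bT apT; have [lT _] := bT.
have /choice[S STW] : forall n : nat, exists S, weakly_compact_ops E S /\
    forall x : E, `|x| <= 1 -> `|T x - S x| <= n.+1%:R^-1.
  move=> n; have [S wS TS] := apT n.+1%:R^-1 (ltac:(by rewrite invr_gt0 ltr0n)).
  exists S; split=> // x; rewrite rnorm_le1 => x1.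
  rewrite -embed_rnorm -(rmorph_nat (embed R k)) -fmorphV embed_le.
  by apply: le_trans (TS x) _; rewrite ler_piMr// invr_ge0.
apply/weakly_compactP => // F FU FB.
have FP : ProperFilter F by exact: ultra_proper.
have /choice[y Sy] : forall n, exists y, forall f : E -> K^o,
    bounded_linear f -> f (S n x) @[x --> F] --> f y.
  by move=> n; have [wS _] := STW n; exact: (iffLR (weakly_compactP wS.1) wS).
(* The factor 2 is the bound of the norming functional; on the unit ball [S n] and [S m] are each
   within their own error of [T]. *)
have ydist n m : `|y n - y m| <= 2 * (n.+1%:R^-1 + m.+1%:R^-1).
  have [f [lf f2 fy]] := norming_functional (y n - y m).
  have bf : bounded_linear f by split=> //; exists 2.
  apply: le_trans fy _.
  apply: (@cvg_norm_le _ _ _ _ (fun x => f (S n x - S m x)) _ _ _ FP FB).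
    under eq_fun do rewrite linB//.
    by rewrite linB//; apply: cvgB; exact: Sy.
  move=> x x1; apply: le_trans (f2 _) _; rewrite ler_pM2l//.
  rewrite -(subrKA (T x)) (le_trans (ler_normD _ _))// lerD//.
    by rewrite distrC; have [_] := STW n; exact.
  by have [_] := STW m; exact.
have /cvg_ex[/= l yl] : cvg (y @ \oo).
  apply: cauchy_cvg; apply: cauchy_exP => e e0.
  (* By [ydist], indices from [N] on give distances below [2 * (e / 4 + e / 4) = e]. *)
  have [N _ Ne] := near_infty_natSinv_scalar (divr_gt0 e0 (ltr0n _ 4 : 0 < 4)).
  exists (y N), N => // n /= Nn; rewrite -ball_normE /=.
  apply: le_lt_trans (ydist N n) _.
  have -> : e = 2 * (e / 4 + e / 4) by field.
  by rewrite ltr_pM2l// ltrD//; apply: Ne => /=.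
exists l => f bf; have [lf _] := bf.
have [M M0 fM] := bounded_linear_gt0 bf.
have fle x : `|f x| <= embed R k M * `|x|.
  by rewrite -!embed_rnorm -rmorphM embed_le.
have M0' : 0 < embed R k M by rewrite embed_gt0.
apply/cvgrPdist_lt => e e0.
(* Vectors shorter than this have images under [f] below [e / 3]. This settles the first and last of
   the three terms in the final splitting; weak convergence along [F] settles the middle one. *)
have d0 : 0 < e / 3 / embed R k M by rewrite !divr_gt0.
have [n [ln nd]] : exists n, `|l - y n| < e / 3 / embed R k M /\
    n.+1%:R^-1 < e / 3 / embed R k M.
  have nsmall := near_infty_natSinv_scalar d0.
  exact: filter_ex (filterI (cvgr_dist_lt _ _ yl _ d0) nsmall).
have e30 : 0 < e / 3 by rewrite divr_gt0.
near=> x.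
have x1 : `|x| <= 1 by near: x.
have yx : `|f (y n) - f (S n x)| < e / 3.
  by near: x; exact: (cvgr_dist_lt _ _ (Sy n f bf)).
have fsmall u : `|u| < e / 3 / embed R k M -> `|f u| < e / 3.
  move=> u_lt; apply: le_lt_trans (fle u) _.
  by rewrite -ltr_pdivlMl// mulrC.
have ly := fsmall _ ln.
have Sx : `|f (S n x - T x)| < e / 3.
  apply: fsmall; apply: le_lt_trans nd; rewrite distrC.
  by have [_] := STW n; exact.
have fB u v : f (u - v) = f u - f v by exact: linB.
have -> : f l - f (T x) = f (l - y n) + (f (y n) - f (S n x)) + f (S n x - T x).
  by rewrite !fB (subrKA (f (y n))) (subrKA (f (S n x))).
rewrite (le_lt_trans (ler_normD _ _))//.
have -> : e = e / 3 + e / 3 + e / 3 by field.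
by rewrite ltrD// (le_lt_trans (ler_normD _ _))// ltrD.
Unshelve. all: by end_near. Qed.

End BoundedOperators.

(** * Ideals of codimension one and the final contradiction *)

Lemma two_sided_ideal_proper (R : realType) (k : scalar_kind)
    (E : normedModType (scalar_field R k)) (J : set (E -> E)) :
  two_sided_ideal J -> codimension_one J -> ~ J id.
Proof.
by move=> [_ _ _ _ JR] [S [bS nJS _]] Jid; apply: nJS; exact: (JR S id bS Jid).
Qed.

Lemma bounded_ops_id (R : realType) (k : scalar_kind)
  (E : normedModType (scalar_field R k)) : bounded_ops E id.
Proof. by split=> //; exists 1 => x; rewrite mul1r. Qed.

(** Modulo [J], [id] is [s *: S], with [s] nonzero because [id] is not in [J]; hence [T], which is
    [a *: S] modulo [J], is also [(a / s) *: id]. *)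
Lemma codimension_one_id (R : realType) (k : scalar_kind)
    (E : normedModType (scalar_field R k)) (J : set (E -> E)) T :
  two_sided_ideal J -> codimension_one J -> bounded_ops E T ->
  exists a, exists2 j, J j & forall x, T x = a *: x + j x.
Proof.
move=> idealJ codimJ bT; have nJid := two_sided_ideal_proper idealJ codimJ.
have [_ _ JD _ _] := idealJ; have [S [bS nJS JS]] := codimJ.
have [s Js] := JS id (bounded_ops_id E); have [a Ja] := JS T bT.
have s0 : s != 0.
  by apply: contra_notN nJid => /eqP s0; move: Js; rewrite s0 scale0r subr0.
exists (a / s), (T - (a / s) *: id) => [|x]; last first.
  by rewrite !fctE /= [RHS]addrC subrK.
have -> : T - (a / s) *: id = (- (a / s)) *: (id - s *: S) + (T - a *: S).
  rewrite scalerBr scalerA mulNr divfK// !scaleNr opprK.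
  by rewrite [RHS]addrC [X in _ = _ + X]addrC addrA subrK.
exact: JD.
Qed.

Theorem theorem3 (R : realType) (k : scalar_kind)
    (ER : completeNormedModType (scalar_field R k)) (JR : set (ER -> ER)) :
  two_sided_ideal JR -> opnorm_closed JR -> codimension_one JR ->
  weakly_compact_ops ER `<` JR ->
  (forall S T : ER -> ER, JR S -> JR T -> weakly_compact_ops ER (S \o T)) ->
  ~ UPFP ER.
Proof.
move=> idealJ _ codimJ [_ /existsNP[T /not_implyP[JT nWT]]] JJ [C C1 pfp].
have nJid := two_sided_ideal_proper idealJ codimJ.
have [Jb J0 JZD JL Jr] := idealJ.
have JZ a S : JR S -> JR (a *: S).
  by move=> JS; rewrite -[_ *: _]addr0; exact: JZD.
have JD S S' : JR S -> JR S' -> JR (S + S').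
  by move=> JS; rewrite -[S]scale1r; exact: JZD.
have JN S : JR S -> JR (- S) by rewrite -scaleN1r; exact: JZ.
apply: nWT; apply: weakly_compact_ops_closed => [|e e0]; first exact: Jb.
(* With this choice the bound [(C + 1) / t] on the norm of UTV is exactly [e]. *)
pose t := embed R k ((C + 1) / e).
have C0 : 0 < C + 1 by rewrite addr_gt0// (lt_le_trans ltr01).
have JtT : JR (t *: T) by exact: JZ.
have [U [V [bU bV UTV UV]]] := pfp _ (Jb _ JtT).
case: UTV => [UTVid|UTV]; first by case: nJid; rewrite -UTVid; exact/Jr/JL.
have [lU _] := bU; have [lT _] := Jb _ JT.
have UVE x : U (V x) = x + t *: U (T (V x)).
  have /= := congr1 (fun f => f x) UTV.
  by rewrite !fctE /= linB// linZ// => /eqP; rewrite subr_eq => /eqP.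
have [u [j Jj UE]] := codimension_one_id idealJ codimJ bU.
have [v [j' Jj' VE]] := codimension_one_id idealJ codimJ bV.
have uv1 : u * v = 1.
  apply/eqP; rewrite -subr_eq0; apply: contra_notT nJid => uv1.
  suff : JR ((u * v - 1) *: id)
    by move/(JZ (u * v - 1)^-1); rewrite scalerA mulVf// scale1r.
  (* Equate the two expansions of UV, namely 1 + tUTV and uv + uj' + jV. *)
  have -> : (u * v - 1) *: id = (U \o (t *: T) \o V) - (u *: j' + (j \o V)).
    apply/funext => x; rewrite !fctE /= linZ//; have := UVE x.
    rewrite {1}UE {1}VE scalerDr scalerA -addrA => /(canRL (addrK _)) E.
    by rewrite scalerBl scale1r E addrAC (addrC x) addrK.
  apply: (JD); first by apply: Jr => //; apply: JL.
  by apply: JN; apply: JD; [exact: JZ | exact: Jr].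
(* These are minus the error terms in UTV = T + jTV + uTj'. Each is a product of two elements of
   [JR], since TV and uT lie in the ideal. *)
exists (((- j) \o (T \o V)) + ((- u *: T) \o j')) => [|x].
  apply: weakly_compact_opsD; apply: JJ => //.
  - exact: JN.
  - exact: Jr.
  - exact: JZ.
have -> : T x - (((- j) \o (T \o V)) + ((- u *: T) \o j')) x = U (T (V x)).
  rewrite !fctE /= [RHS]UE {2}VE (linD lT) (linZ lT) scalerDr scalerA uv1.
  by rewrite scale1r scaleNr opprD !opprK addrAC addrA.
have tUTV : t *: U (T (V x)) = U (V x) - x by rewrite UVE addrAC subrr add0r.
have := rnormD (U (V x)) (- x).
rewrite -tUTV rnormZ ?divr_ge0 ?(ltW C0) ?(ltW e0)// rnormN => UTVx.
have UVx : rnorm (U (V x)) <= C * rnorm x.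
  apply: le_trans (opnorm_ub (V x) bU) _.
  apply: le_trans (ler_wpM2l (opnorm_ge0 bU) (opnorm_ub x bV)) _.
  by rewrite mulrA ler_wpM2r// rnorm_ge0.
rewrite -(ler_pM2l (divr_gt0 C0 e0)) (le_trans UTVx)//.
by rewrite mulrA divfK ?gt_eqF// mulrDl mul1r lerD.
Qed.
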